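(* Consider the multi-agent goal recognition problem, the hypothesis score $S_t$, and the exhaustive and pruned recognizers defined in the context, all using the same non-competitive score and retaining the top $m$ complete hypotheses. Let $t$ be any observed step, and list the scores $S_t(h)$ of all complete hypotheses in non-increasing order $\sigma_1\ge\sigma_2\ge\cdots\ge\sigma_M$, where $M$ is the total number of complete hypotheses and $m<M$. Then for every pruned variant (Scoring Prune, Partition B&B, Local B&B, Ranking B&B, Full B&B): (i) if there is a strict score gap at the top-$m$ boundary, $\sigma_m>\sigma_{m+1}$, the pruned variant returns at step $t$ the same top-$m$ ranking (the same $m$ hypotheses, ranked by score) as exhaustive search; (ii) if $\sigma_m=\sigma_{m+1}$, the pruned variant returns at step $t$ a ranking that agrees with the exhaustive one up to the choice among hypotheses tied at the boundary: it returns $m$ hypotheses with scores $\sigma_1,\dots,\sigma_m$, including every hypothesis with score strictly greater than $\sigma_m$.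
   Context: **Problem.** $A=\{1,\dots,N\}$ is a finite set of agents. $\mathcal P$ is a finite set of candidate indexed partitions $P=\{T_1,\dots,T_K\}$ of $A$ into $K$ disjoint teams with $\bigcup_k T_k=A$; the index $k$ is a team-slot label. For each slot $k$, $\mathcal G_k$ is a finite nonempty set of candidate goals. A complete hypothesis is $h=(P,g_1,\dots,g_K)$ with $P\in\mathcal P$, $g_k\in\mathcal G_k$. The observer sees a trajectory $(s_\tau,a_\tau)_{\tau=1}^{t}$ of world states and joint actions $a_\tau=(a_\tau^1,\dots,a_\tau^N)$, revealed one step at a time. Action spaces are finite, and $\pi_\theta(\cdot\mid o,c)$ is a fixed policy giving a probability distribution over actions for each policy input $o$ and teammate-action context $c$. **Score.** Given $h$, let $o_\tau^i(h)$ be the policy input for agent $i$ built from $s_\tau$ and the team and goal features specified by $h$ for agent $i$. Let $c_\tau^i(h)$ be the tuple of recorded actions (from $a_\tau$) of the agents that $h$ places in the same team as $i$ and that are earlier than $i$ in a fixed within-team order. Fix $\varepsilon\in(0,1)$ and $\lambda>0$. The hypothesis score is $$S_t(h)=\sum_{\tau=1}^{t}\sum_{i=1}^{N}\log\max\big(\pi_\theta(a_\tau^i\mid o_\tau^i(h),c_\tau^i(h)),\varepsilon\big),$$ with two conventions. If $a_\tau^i$ is infeasible under the action constraints of $h$, the $(\tau,i)$ term is replaced by $\log\varepsilon$. If $t$ is the final step of a trajectory that has terminated without truncation, then for each team $k$ whose candidate goal $g_k$ is not satisfied in the final state, $\lambda$ is subtracted once (terminal penalty). **Non-competitive score.** The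 score is non-competitive if, for the fixed observed trajectory and any partition $P$, each agent-level term for $i\in T_k$ and any terminal penalty for team $k$ depend on $T_k$ and $g_k$, but not on the candidate goals of the other teams. The inputs and contexts for $i\in T_k$ are then written $o_\tau^i(T_k,g_k)$ and $c_\tau^i(T_k,g_k)$. **Local score.** For $P=\{T_1,\dots,T_K\}$ and $g\in\mathcal G_k$, $$S_t(T_k,g)=\sum_{\tau=1}^{t}\sum_{i\in T_k}\log\max\big(\pi_\theta(a_\tau^i\mid o_\tau^i(T_k,g),c_\tau^i(T_k,g)),\varepsilon\big),$$ with infeasible actions again contributing $\log\varepsilon$, and with $\lambda$ subtracted once if the trajectory has terminated without truncation at step $t$ and $g$ is unsatisfied in the final state. By convention $S_0(T_k,g)=0$. **Bounds.** The partition bound is $U_t(P)=\sum_{k=1}^K\max_{g\in\mathcal G_k}S_t(T_k,g)$. The stale bound $\widetilde U_t(P)$ available at the start of step $t$ is $U_{t'}(P)$, where $t'<t$ is the last earlier step at which the local scores of $P$ were refreshed, and $\widetilde U_t(P)=U_0(P)=0$ if they were never refreshed. **Full B&B** (retained list size $m\ge1$). At each step $t$: - Start with an empty min-heap $\mathcal H$ of capacity $m$ and $F=-\infty$. Process the partitions of $\mathcal P$ in descending order of $\widetilde U_t(P)$. - *Scoring-stage test:* if $\mathcal H$ is full and $\widetilde U_t(P)\le F$, skip $P$. Otherwise refresh, i.e. compute $S_t(T_k,g)$ for all $k$ and all $g\in\mathcal G_k$, and compute $U_t(P)$. - *Partition-level test:* if $\mathcal H$ is full and $U_t(P)\le F$,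 drop $P$. Otherwise sort each $\mathcal G_k$ by $S_t(T_k,\cdot)$ in descending order. An index tuple $(j_1,\dots,j_K)$ denotes the complete hypothesis using the $j_k$-th goal of the $k$-th sorted list for every $k$; its score is the sum of the selected local scores. Initialize a max-priority queue (keyed by tuple score) and a set *seen*, both containing only $(1,\dots,1)$. - *Local loop with local-level test:* while the queue is nonempty, fewer than $m$ tuples have been emitted for this partition at this step, and either $\mathcal H$ is not full or the best tuple score in the queue exceeds $F$: pop the best tuple, emit its complete hypothesis, and insert it into $\mathcal H$ if it belongs to the current top-$m$ set of emitted hypotheses (removing a lowest entry if over capacity). Then push each one-coordinate successor (one $j_k$ increased by $1$, within range) not in *seen* onto the queue and add it to *seen*. - After each partition (whether skipped, dropped or searched), if $\mathcal H$ is full, set $F$ to the smallest score in $\mathcal H$. - At the end of the step, each refreshed $U_t(P)$ becomes the stale bound of $P$, and $\mathcal H$ is output as the ranking for step $t$. **Variants.** All variants use the same local scores and the same complete-hypothesis score, and differ only in which of the three pruning stages are enabled. A disabled scoring-stage or partition-level test never skips or drops a partition. If the local stage is disabled, all goal tuples of each partition that is searched are emitted (no early stopping). Exhaustive search enables none of the stages, so it emits every complete hypothesis at every step and keeps the best $m$. Scoring Prune enables only the scoring-stage test; Partition B&B only the partition-level test; Local B&B only the local stage; Ranking B&B the partition-level and local stages; Full B&B all three. *)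

(* Defs.v *)
From mathcomp Require Import all_boot all_order all_algebra.
From mathcomp Require Import reals constructive_ereal exp.

Set Implicit Arguments.
Unset Strict Implicit.
Unset Printing Implicit Defensive.
Import Order.TTheory GRing.Theory Num.Theory.
Local Open Scope ring_scope.

(* Agents are 'I_N and team slots are 'I_K.  A family of teams indexed by the
   slots; teams may be empty. *)
Definition teams (N K : nat) := {ffun 'I_K -> {set 'I_N}}.

Definition is_indexed_partition (N K : nat) (P : teams N K) : bool :=
  [forall k, forall l, (k != l) ==> [disjoint P k & P l]] &&
  (\bigcup_k P k == [set: 'I_N]).

(* The components (P, (g_k)_k) of a complete hypothesis. *)
Definition hypothesis (N K : nat) (goal : finType) : Type :=
  (teams N K * {ffun 'I_K -> goal})%type.

Record model (R : realType) (N K : nat) := Model {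
  state : Type;
  action : finType;
  input : Type;
  goal : finType;
  partitions : {set teams N K};
  partitionsP : forall P, P \in partitions -> is_indexed_partition P;
  goals : 'I_K -> {set goal};
  goals_neq0 : forall k, goals k != set0;
  (* policy o c a is pi_theta(a | o, c); a context is a tuple of actions *)
  policy : input -> seq action -> action -> R;
  policy_ge0 : forall o c a, 0 <= policy o c a;
  policy_sum1 : forall o c, \sum_a policy o c a = 1;
  (* the members of a team, listed in the fixed within-team order *)
  team_order : {set 'I_N} -> seq 'I_N;
  team_orderP : forall T : {set 'I_N}, perm_eq (team_order T) (enum T);
  (* The policy input, the feasibility of an agent's component of a joint
     action, and the satisfaction of the goal of a slot may a priori depend on
     the whole hypothesis; see [noncompetitive]. *)
  policy_input : state -> hypothesis N K goal -> 'I_N -> input;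
  feasible :
    state -> {ffun 'I_N -> action} -> hypothesis N K goal -> 'I_N -> bool;
  satisfied : state -> hypothesis N K goal -> 'I_K -> bool;
  epsilon : R;
  epsilon_gt0 : 0 < epsilon;
  epsilon_lt1 : epsilon < 1;
  lambda : R;
  lambda_gt0 : 0 < lambda
}.

(* The observed steps are 1, ..., horizon; values of [world] and [joint] at
   other indices are irrelevant.  [terminated] means terminated without
   truncation.  The final state is kept separate from [world horizon], so that
   it may be either this state or the one reached by the last joint action. *)
Record trajectory (R : realType) (N K : nat) (M : model R N K) := Trajectory {
  horizon : nat;
  world : nat -> state M;
  joint : nat -> {ffun 'I_N -> action M};
  terminated : bool;
  final_state : state M
}.

(* The data written o(T_k, g_k) etc. in the non-competitive case.  The slot k
   is passed along with T_k, since a team of an indexed partition carries its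
   slot label. *)
Record local_data (R : realType) (N K : nat) (M : model R N K) := LocalData {
  loc_input : state M -> 'I_K -> {set 'I_N} -> goal M -> 'I_N -> input M;
  loc_feasible : state M -> {ffun 'I_N -> action M} ->
    'I_K -> {set 'I_N} -> goal M -> 'I_N -> bool;
  loc_satisfied : state M -> 'I_K -> {set 'I_N} -> goal M -> bool
}.

Section Scores.
Variables (R : realType) (N K : nat) (M : model R N K) (tr : trajectory M).

Definition hypotheses : {set hypothesis N K (goal M)} :=
  [set h : hypothesis N K (goal M) | (h.1 \in partitions M) && [forall k, h.2 k \in goals M k]].

(* the team of agent i in P (the union has a single term) *)
Definition team_of (P : teams N K) (i : 'I_N) : {set 'I_N} :=
  \bigcup_(k | i \in P k) P k.

(* recorded actions at step tau of the members of T that precede i *)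
Definition context (tau : nat) (T : {set 'I_N}) (i : 'I_N) : seq (action M) :=
  [seq joint tr tau j | j <- take (index i (team_order M T)) (team_order M T)].

Definition clipped_log (o : input M) (c : seq (action M)) (a : action M) : R :=
  ln (Num.max (policy o c a) (epsilon M)).

Definition agent_term (h : hypothesis N K (goal M)) (tau : nat) (i : 'I_N) : R :=
  if feasible (world tr tau) (joint tr tau) h i then
    clipped_log (policy_input (world tr tau) h i)
                (context tau (team_of h.1 i) i) (joint tr tau i)
  else ln (epsilon M).

Definition terminal (t : nat) : bool := terminated tr && (t == horizon tr).

Definition penalty (t : nat) (h : hypothesis N K (goal M)) (k : 'I_K) : R :=
  if terminal t && ~~ satisfied (final_state tr) h k then lambda M else 0.

Definition score (t : nat) (h : hypothesis N K (goal M)) : R :=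
  \sum_(1 <= tau < t.+1) \sum_i agent_term h tau i - \sum_k penalty t h k.

Variable L : local_data M.

Definition local_term (k : 'I_K) (T : {set 'I_N}) (g : goal M)
    (tau : nat) (i : 'I_N) : R :=
  if loc_feasible L (world tr tau) (joint tr tau) k T g i then
    clipped_log (loc_input L (world tr tau) k T g i)
                (context tau T i) (joint tr tau i)
  else ln (epsilon M).

Definition local_penalty (t : nat) (k : 'I_K) (T : {set 'I_N}) (g : goal M) : R :=
  if terminal t && ~~ loc_satisfied L (final_state tr) k T g
  then lambda M else 0.

(* The terms and penalties of the score depend on (T_k, g_k) only, through L. *)
Definition noncompetitive : Prop :=
  forall h, h \in hypotheses -> forall k : 'I_K,
    (forall tau i, (0 < tau <= horizon tr)%N -> i \in h.1 k ->
       agent_term h tau i = local_term k (h.1 k) (h.2 k) tau i) /\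
    (forall t, (0 < t <= horizon tr)%N ->
       penalty t h k = local_penalty t k (h.1 k) (h.2 k)).

Definition local_score (t : nat) (k : 'I_K) (T : {set 'I_N}) (g : goal M) : R :=
  \sum_(1 <= tau < t.+1) \sum_(i in T) local_term k T g tau i
    - local_penalty t k T g.

(* an arbitrary candidate goal for slot k, used as a default element *)
Definition goal0 (k : 'I_K) : goal M :=
  xchoose (elimT (set0Pn _) (goals_neq0 M k)).

(* The default of the maximum is one of the values over which it ranges. *)
Definition bound (t : nat) (P : teams N K) : R :=
  \sum_k \big[Num.max/local_score t k (P k) (goal0 k)]_(g in goals M k)
    local_score t k (P k) g.

End Scores.

Inductive variant :=
  Exhaustive | ScoringPrune | PartitionBB | LocalBB | RankingBB | FullBB.

Definition scoring_stage (v : variant) : bool :=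
  match v with ScoringPrune | FullBB => true | _ => false end.

Definition partition_stage (v : variant) : bool :=
  match v with PartitionBB | RankingBB | FullBB => true | _ => false end.

Definition local_stage (v : variant) : bool :=
  match v with LocalBB | RankingBB | FullBB => true | _ => false end.

(* The recognizers are given as big-step relations, so as to allow every way of
   breaking ties: in the processing order of the partitions, in the sorting of
   the goals, in the choice of a best tuple of a queue, in the choice of a
   lowest heap entry and in the ranking of the output.  Heaps, queues and sets
   of seen tuples are sequences whose order is irrelevant. *)
Section Recognizers.
Variables (R : realType) (N K : nat) (M : model R N K) (tr : trajectory M).
Variables (L : local_data M) (v : variant) (m t : nat).

Local Notation hyp := (hypothesis N K (goal M)).
Local Notation S_t := (score tr t).
Local Notation index_tuple := {ffun 'I_K -> nat}.

Definition full (H : seq hyp) : bool := (m <= size H)%N.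

(* smallest score of a nonempty heap *)
Definition heap_min (H : seq hyp) : \bar R :=
  \big[Order.min/+oo%E]_(h <- H) (S_t h)%:E.

(* When the heap is full, h is added and a lowest entry is removed.  If h is
   not in the current top m, it is itself the lowest entry and the heap is
   unchanged; if h ties with the lowest entries, any of them may go. *)
Inductive heap_insert (h : hyp) (H : seq hyp) : seq hyp -> Prop :=
| InsertRoom : ~~ full H -> heap_insert h H (h :: H)
| InsertEvict x : full H -> x \in h :: H ->
    (forall y, y \in h :: H -> S_t x <= S_t y) ->
    heap_insert h H (rem x (h :: H)).

Inductive emit_all : seq hyp -> seq hyp -> seq hyp -> Prop :=
| EmitNil H : emit_all [::] H H
| EmitCons h hs H H1 H2 :
    heap_insert h H H1 -> emit_all hs H1 H2 -> emit_all (h :: hs) H H2.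

Section LocalSearch.
(* the partition, the sorted goal lists and the current value of F *)
Variables (P : teams N K) (G : 'I_K -> seq (goal M)) (F : \bar R).

Definition sorted_goals : Prop :=
  forall k, perm_eq (G k) (enum (goals M k)) /\
    sorted (fun g g' => local_score tr L t k (P k) g' <=
                        local_score tr L t k (P k) g) (G k).

(* Positions in the sorted lists are counted from 0. *)
Definition start : index_tuple := [ffun=> 0%N].

Definition selected (j : index_tuple) (k : 'I_K) : goal M :=
  nth (goal0 M k) (G k) (j k).

Definition tuple_hyp (j : index_tuple) : hyp := (P, [ffun k => selected j k]).

Definition tuple_score (j : index_tuple) : R :=
  \sum_k local_score tr L t k (P k) (selected j k).

Definition best_score (Q : seq index_tuple) : \bar R :=
  \big[Order.max/-oo%E]_(j <- Q) (tuple_score j)%:E.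

Definition succ_at (j : index_tuple) (k : 'I_K) : index_tuple :=
  [ffun l => if l == k then (j l).+1 else j l].

Definition successors (j : index_tuple) : seq index_tuple :=
  [seq succ_at j k | k <- enum 'I_K & ((j k).+1 < size (G k))%N].

(* n is the number of tuples already emitted for P at this step *)
Definition local_guard (Q : seq index_tuple) (n : nat) (H : seq hyp) : bool :=
  [&& Q != [::], (n < m)%N & ~~ full H || (F < best_score Q)%E].

(* local_loop Q seen n H H': the loop started with queue Q, set of seen tuples
   seen, n emitted tuples and heap H may end with heap H' *)
Inductive local_loop :
    seq index_tuple -> seq index_tuple -> nat -> seq hyp -> seq hyp -> Prop :=
| LoopStop Q seen n H : ~~ local_guard Q n H -> local_loop Q seen n H H
| LoopStep Q seen n H j H1 H2 :
    local_guard Q n H ->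
    j \in Q -> (forall j', j' \in Q -> tuple_score j' <= tuple_score j) ->
    heap_insert (tuple_hyp j) H H1 ->
    (let new := [seq j' <- successors j | j' \notin seen] in
     local_loop (new ++ rem j Q) (new ++ seen) n.+1 H1 H2) ->
    local_loop Q seen n H H2.

End LocalSearch.

Definition hypotheses_of (P : teams N K) : {set hyp} :=
  [set h in hypotheses M | h.1 == P].

Inductive search (P : teams N K) (F : \bar R) (H H' : seq hyp) : Prop :=
| SearchLocal G :
    local_stage v -> sorted_goals P G ->
    local_loop P G F [:: start] [:: start] 0 H H' -> search P F H H'
| SearchAll hs :
    ~~ local_stage v -> perm_eq hs (enum (hypotheses_of P)) ->
    emit_all hs H H' -> search P F H H'.

Section Step.
(* the stale bounds at the start of step t *)
Variable stale : teams N K -> R.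

Definition skips (P : teams N K) (F : \bar R) (H : seq hyp) : bool :=
  [&& scoring_stage v, full H & ((stale P)%:E <= F)%E].

Definition drops (P : teams N K) (F : \bar R) (H : seq hyp) : bool :=
  [&& partition_stage v, full H & ((bound tr L t P)%:E <= F)%E].

Inductive process (P : teams N K) (F : \bar R) (H : seq hyp) :
    seq hyp -> Prop :=
| ProcessSkip : skips P F H -> process P F H H
| ProcessDrop : ~~ skips P F H -> drops P F H -> process P F H H
| ProcessSearch H' :
    ~~ skips P F H -> ~~ drops P F H -> search P F H H' -> process P F H H'.

(* pass Ps F H H' rf: processing the partitions Ps in this order from threshold
   F and heap H may end with heap H' after refreshing the partitions rf *)
Inductive pass : seq (teams N K) -> \bar R -> seq hyp ->
    seq hyp -> seq (teams N K) -> Prop :=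
| PassNil F H : pass [::] F H H [::]
| PassCons P Ps F H H1 H2 rf :
    process P F H H1 ->
    pass Ps (if full H1 then heap_min H1 else F) H1 H2 rf ->
    pass (P :: Ps) F H H2 (if skips P F H then rf else P :: rf).

Definition ranked (r : seq hyp) : bool :=
  sorted (fun h h' => S_t h' <= S_t h) r.

(* step r stale': step t may output r and leave the stale bounds stale' *)
Definition step (r : seq hyp) (stale' : teams N K -> R) : Prop :=
  exists Ps H rf,
    [/\ perm_eq Ps (enum (partitions M)) /\
          sorted (fun P P' => stale P' <= stale P) Ps,
        pass Ps -oo%E [::] H rf,
        perm_eq r H /\ ranked r &
        stale' = fun P => if P \in rf then bound tr L t P else stale P].

End Step.
End Recognizers.

(* stale_after tr L v m t b: b is a possible table of stale bounds after the
   steps 1, ..., t *)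
Inductive stale_after (R : realType) (N K : nat) (M : model R N K)
    (tr : trajectory M) (L : local_data M) (v : variant) (m : nat) :
    nat -> (teams N K -> R) -> Prop :=
| StaleInit : stale_after tr L v m 0 (fun=> 0)
| StaleStep t b r b' :
    stale_after tr L v m t b -> step tr L v m t.+1 b r b' ->
    stale_after tr L v m t.+1 b'.

(* Variant v, run from the first step, may return the ranking r at step t. *)
Definition returns (R : realType) (N K : nat) (M : model R N K)
    (tr : trajectory M) (L : local_data M) (v : variant) (m t : nat)
    (r : seq (hypothesis N K (goal M))) : Prop :=
  exists b b', stale_after tr L v m t.-1 b /\ step tr L v m t b r b'.

(* Main.v *)
Require Import Defs.
From mathcomp Require Import all_boot all_order all_algebra.
From mathcomp Require Import reals constructive_ereal exp.
Import Order.TTheory GRing.Theory Num.Theory.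
Local Open Scope ring_scope.

Set Implicit Arguments.
Unset Strict Implicit.

(* The heap always holds a top-m selection, for some choice among ties, of the
   hypotheses whose partition has been processed.  This survives pruning: the
   threshold F is at most every score of a full heap, while the scores of the
   hypotheses left out are at most F.  Indeed the local scores are sums of
   nonpositive terms minus a nonnegative penalty charged only at the last step,
   hence nonincreasing in time, so a stale bound dominates the current bound of
   a partition, which dominates its hypotheses; and every tuple not yet emitted
   lies coordinatewise above some tuple of the queue, which scores at least as
   much.  If the local loop stops after m emissions, the m emitted tuples
   dominate the others, and no entry of the heap can be worse than all of them.
   The heap at the end of a step is thus a top-m selection of all hypotheses,
   and two such selections differ at most in hypotheses tied at the boundary. *)

(** * Regrouping sums by team, and choosing maximal elements of lists *)

Lemma sum_indexed_partition (R : nmodType) (N K : nat) (P : teams N K)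
    (f : 'I_N -> R) :
  is_indexed_partition P -> \sum_i f i = \sum_k \sum_(i in P k) f i.
Proof.
case/andP=> /forallP disjP /eqP coverP.
under [RHS]eq_bigr => k _ do rewrite big_mkcond.
rewrite exchange_big; apply: eq_bigr => i _ /=.
(* Covering gives a slot containing [i], and disjointness makes it the only one, so the exchanged
   inner sum has a single term. *)
have /bigcupP[k _ Pki] : i \in \bigcup_k P k by rewrite coverP inE.
rewrite -big_mkcond (big_pred1 k) // => l /=.
apply/idP/eqP => [Pli | -> //]; apply/eqP; apply: contraLR Pki => nkl.
by rewrite (disjointFr (implyP (forallP (disjP l) k) nkl)).
Qed.

(** Supplies the choices made in a run: a best tuple of the queue and, applied to the negated score,
    a lowest heap entry. *)
Lemma seq_argmax (R : realDomainType) (T : eqType) (f : T -> R) (s : seq T) :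
  s != [::] -> exists2 x, x \in s & forall y, y \in s -> f y <= f x.
Proof.
elim: s => // a [|b s] IH _.
  by exists a; rewrite ?mem_head // => y; rewrite inE => /eqP->.
have [//|x sx maxx] := IH.
have [le_xa | lt_ax] := leP (f x) (f a).
  exists a; rewrite ?mem_head // => y; rewrite inE => /predU1P[-> // | /maxx].
  by move/le_trans; apply.
exists x; first by rewrite inE sx orbT.
by move=> y; rewrite inE => /predU1P[-> | /maxx//]; apply: ltW.
Qed.

Lemma ge_total (R : realDomainType) (T : Type) (f : T -> R) :
  total (fun x y => f y <= f x).
Proof. by move=> x y; apply: le_total. Qed.

Lemma ge_transitive (R : realDomainType) (T : Type) (f : T -> R) :
  transitive (fun x y => f y <= f x).
Proof. by move=> y x z yx zy; apply: le_trans yx. Qed.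

(** * Local scores and partition bounds: sign, monotonicity in time, domination *)

Section LocalScores.
Variables (R : realType) (N K : nat) (M : model R N K) (tr : trajectory M).
Variable L : local_data M.

Lemma policy_le1 (o : input M) (c : seq (action M)) a : policy o c a <= 1.
Proof.
rewrite -(policy_sum1 (m := M) o c) (bigD1 a) //= lerDl sumr_ge0 // => b _.
exact: policy_ge0.
Qed.

Lemma local_term_le0 k T g tau i : local_term tr L k T g tau i <= 0.
Proof.
rewrite /local_term /clipped_log.
case: ifP => _; apply: ln_le0; last exact/ltW/epsilon_lt1.
by rewrite ge_max policy_le1 ltW ?epsilon_lt1.
Qed.

Lemma local_penalty_ge0 t k T g : 0 <= local_penalty tr L t k T g.
Proof. by rewrite /local_penalty; case: ifP => // _; apply/ltW/lambda_gt0. Qed.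

Lemma local_score_le0 t k T g : local_score tr L t k T g <= 0.
Proof.
rewrite /local_score subr_le0; apply: le_trans (local_penalty_ge0 _ _ _ _).
by apply: sumr_le0 => tau _; apply: sumr_le0 => i _; apply: local_term_le0.
Qed.

(* The terminal penalty cannot break monotonicity: it is only charged at the
   last step. *)
Lemma local_score_nonincreasing t t' k T g : (t <= t' <= horizon tr)%N ->
  local_score tr L t' k T g <= local_score tr L t k T g.
Proof.
case/andP; rewrite leq_eqVlt => /predU1P[-> // | lt_tt'] le_t'h.
have pen0 : local_penalty tr L t k T g = 0.
  by rewrite /local_penalty /terminal (ltn_eqF (leq_trans lt_tt' le_t'h)) andbF.
rewrite /local_score pen0 subr0 lerBlDr.
apply: le_trans (_ : _ <= \sum_(1 <= tau < t.+1)
  \sum_(i in T) local_term tr L k T g tau i) _; last first.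
  by rewrite lerDl local_penalty_ge0.
rewrite (big_cat_nat (n := t.+1)) //=; last by rewrite ltnS ltnW.
rewrite gerDl; apply: sumr_le0 => tau _.
by apply: sumr_le0 => i _; apply: local_term_le0.
Qed.

Lemma goal0P k : goal0 M k \in goals M k.
Proof. exact: xchooseP. Qed.

Lemma local_score_le_max t k T g : g \in goals M k ->
  local_score tr L t k T g <=
  \big[Num.max/local_score tr L t k T (goal0 M k)]_(g in goals M k)
    local_score tr L t k T g.
Proof.
by move=> gk; apply: (le_bigmax_cond _ (fun g => local_score tr L t k T g)).
Qed.

Lemma bound_nonincreasing t t' P : (t <= t' <= horizon tr)%N ->
  bound tr L t' P <= bound tr L t P.
Proof.
move=> tt'; apply: ler_sum => k _.
have le_max g : g \in goals M k -> local_score tr L t' k (P k) g <=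
    \big[Num.max/local_score tr L t k (P k) (goal0 M k)]_(g in goals M k)
      local_score tr L t k (P k) g.
  move=> gk; apply: le_trans (local_score_nonincreasing _ _ _ tt') _.
  exact: local_score_le_max.
(* The default of the maximum is the score of the candidate goal [goal0], so it falls under [le_max]
   too. *)
by apply: bigmax_le => [|g]; apply: le_max; first exact: goal0P.
Qed.

(** Makes 0 an admissible stale bound for a partition that was never refreshed. *)
Lemma bound_le0 t P : bound tr L t P <= 0.
Proof.
apply: sumr_le0 => k _.
by apply: bigmax_le => [|g _]; apply: local_score_le0.
Qed.

Hypothesis nc : noncompetitive tr L.

(** The agents are regrouped by team and the two sums exchanged; the range of [t] ensures that every
    [tau] summed over is an observed step, where noncompetitivity applies. *)
Lemma scoreE t h : h \in hypotheses M -> (0 < t <= horizon tr)%N ->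
  score tr t h = \sum_k local_score tr L t k (h.1 k) (h.2 k).
Proof.
move=> hM t_range; rewrite /score /local_score sumrB; congr (_ - _); last first.
  by apply: eq_bigr => k _; have [_ ->] := nc hM k.
rewrite [RHS]exchange_big /=; apply: eq_big_nat => tau /andP[tau0 taut].
rewrite (@sum_indexed_partition _ _ _ h.1); last first.
  by move: hM; rewrite inE => /andP[/partitionsP].
apply: eq_bigr => k _; apply: eq_bigr => i ik.
have [-> //] := nc hM k.
case/andP: t_range => _; rewrite tau0; apply: leq_trans.
by rewrite -ltnS.
Qed.

Lemma score_le_bound t h : h \in hypotheses M -> (0 < t <= horizon tr)%N ->
  score tr t h <= bound tr L t h.1.
Proof.
move=> hM t_range; rewrite scoreE //; apply: ler_sum => k _.
by apply: local_score_le_max; move: hM; rewrite inE => /andP[_ /forallP].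
Qed.

End LocalScores.

(** * Top-m selections and their preservation by heap insertion *)

Section TopEntries.
Variables (R : realType) (N K : nat) (M : model R N K) (tr : trajectory M).
Variables (m t : nat).
Local Notation hyp := (hypothesis N K (goal M)).
Local Notation S := (score tr t).
Implicit Types (E : {set hyp}) (H : seq hyp).

(** The choice among ties is left open. The last clause also forbids leaving anything out while the
    heap has room. *)
Definition top_entries E H : Prop :=
  [/\ uniq H, {subset H <= E}, (size H <= m)%N &
      forall h, h \in E -> h \notin H ->
        full (M:=M) m H /\ forall y, y \in H -> S h <= S y].

Lemma top_entries_perm E H H' : perm_eq H' H ->
  top_entries E H -> top_entries E H'.
Proof.
move=> HH' [uH sH mH domH]; split; rewrite ?(perm_uniq HH') ?(perm_size HH') //.
  by move=> h; rewrite (perm_mem HH') => /sH.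
move=> h hE; rewrite /full (perm_mem HH') (perm_size HH') => /(domH h hE)[fH dom].
by split=> // y; rewrite (perm_mem HH') => /dom.
Qed.

(** Accounts for pruning: dominated hypotheses count as processed although the heap is unchanged. *)
Lemma top_entriesW E E' H : top_entries E H -> E \subset E' ->
  (forall h, h \in E' -> h \notin E ->
     full (M:=M) m H /\ forall y, y \in H -> S h <= S y) ->
  top_entries E' H.
Proof.
move=> [uH sH mH domH] /subsetP EE' dom; split=> // [h /sH /EE' // | h hE' hH].
by have [hE|hE] := boolP (h \in E); [apply: domH | apply: dom].
Qed.

(** A selection of E' with room left contains all of E', hence every entry of H, and so would be at
    least as long as H. *)
Lemma top_entries_full E E' H H' :
  top_entries E H -> top_entries E' H' -> E \subset E' ->
  full (M:=M) m H -> full (M:=M) m H'.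
Proof.
move=> [uH sH _ _] [uH' _ _ domH'] /subsetP EE' fH.
apply/contraT => nfH'; rewrite -(negPf nfH') /full; apply: leq_trans fH _.
apply: uniq_leq_size => // h /sH /EE' hE'; apply/contraT => hH'.
by have [] := domH' h hE' hH'; rewrite (negPf nfH').
Qed.

(** First of the existence lemmas, which show that every variant has a run, so that the claims about
    returned rankings are not vacuous. *)
Lemma heap_insert_exists h H : exists H', heap_insert tr m t h H H'.
Proof.
have [fH | nfH] := boolP (full (M:=M) m H); last by exists (h :: H); left.
have [//|x xH minx] := @seq_argmax _ hyp (fun x => - S x) (h :: H).
by exists (rem x (h :: H)); right=> // y /minx; rewrite lerN2.
Qed.

Lemma heap_insert_top E h H H' : heap_insert tr m t h H H' ->
  top_entries E H -> h \notin E -> top_entries (h |: E) H'.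
Proof.
move=> ins [uH sH mH domH] hE.
have hH : h \notin H by apply: contra hE => /sH.
case: ins => [nfH | x fH xH minx].
  split; first by rewrite /= hH.
  - by move=> y; rewrite !inE => /predU1P[-> | /sH ->]; rewrite ?eqxx ?orbT.
  - by rewrite /= ltnNge.
  - move=> y; rewrite !inE => /predU1P[-> | yE]; rewrite ?eqxx // negb_or.
    by case/andP=> _ yH; have [] := domH y yE yH; rewrite (negPf nfH).
have uhH : uniq (h :: H) by rewrite /= hH.
have sizeH' : size (rem x (h :: H)) = size H by rewrite size_rem.
split; rewrite ?rem_uniq ?sizeH' //.
  by move=> y /mem_rem; rewrite !inE => /predU1P[-> | /sH ->]; rewrite ?eqxx ?orbT.
move=> z zE; rewrite /full sizeH' => zH; split=> // y yH'.
have [<- | neq_xz] := eqVneq x z; first exact/minx/mem_rem/yH'.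
have zhH : z \notin h :: H.
  by apply: contra zH => zhH; apply: rem_mem; rewrite // eq_sym.
move: zhH; rewrite inE negb_or => /andP[zh zH0].
have {}zE : z \in E by move: zE; rewrite !inE (negPf zh).
have [_ domz] := domH z zE zH0.
move: yH'; rewrite mem_rem_uniq // !inE => /andP[nyx /predU1P[yh | /domz //]].
(* Here the surviving entry [y] is the new [h], while [z] had been left out earlier; they are
   compared through the evicted entry [x] of [H]. *)
move: xH; rewrite inE => /predU1P[xh | xH].
  by rewrite xh yh eqxx in nyx.
by apply: le_trans (domz _ xH) (minx _ _); rewrite yh mem_head.
Qed.

(* F is the threshold in force: -oo until the heap is full, and then the lowest
   score at some earlier moment. *)
Definition valid_threshold (F : \bar R) H : Prop :=
  (forall y, y \in H -> (F <= (S y)%:E)%E) /\ (~~ full (M:=M) m H -> F = -oo%E).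

(** [F] is not updated while a partition is searched. Before the heap is full it is -oo; afterwards
    a surviving new entry scores at least as much as the evicted one. *)
Lemma heap_insert_threshold F h H H' : heap_insert tr m t h H H' ->
  valid_threshold F H -> valid_threshold F H'.
Proof.
case=> [nfH [_ /(_ nfH)->] | x fH xH minx [leF _]].
  by split=> // y _; rewrite leNye.
split=> [y yH' | /negP[]]; last by rewrite /full size_rem.
have := mem_rem yH'; rewrite inE => /predU1P[yh | /leF //].
move: xH; rewrite inE => /predU1P[xh | xH].
  move: yH'; rewrite xh yh /= eqxx.
  exact: leF.
by apply: le_trans (leF _ xH) _; rewrite lee_fin minx // yh mem_head.
Qed.

Lemma emit_all_top hs H H' : emit_all tr m t hs H H' ->
  forall E, top_entries E H -> uniq hs -> {in hs, forall h, h \notin E} ->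
  top_entries (E :|: [set h in hs]) H'.
Proof.
elim=> [{}H E topE _ _ | h {}hs {}H H1 H2 ins _ IH E topE /= /andP[hhs uhs] dis].
  by rewrite (_ : [set h in [::]] = set0) ?setU0 //; apply/setP=> x; rewrite !inE.
have := IH _ (heap_insert_top ins topE (dis _ (mem_head _ _))) uhs.
rewrite set_cons setUCA setUA; apply=> x xs.
by rewrite !inE negb_or dis ?inE ?xs ?orbT // andbT; apply: contraNneq hhs => <-.
Qed.

Lemma emit_all_exists hs H : exists H', emit_all tr m t hs H H'.
Proof.
elim: hs H => [|h hs IH] H; first by exists H; left.
have [H1 ins] := heap_insert_exists h H.
by have [H2 em] := IH H1; exists H2; apply: EmitCons em.
Qed.

End TopEntries.

(** * Best-first search over the index tuples of one partition *)

Section LocalSearch.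
Variables (R : realType) (N K : nat) (M : model R N K) (tr : trajectory M).
Variables (L : local_data M) (m t : nat).
Hypothesis nc : noncompetitive tr L.
Hypothesis t_range : (0 < t <= horizon tr)%N.
Local Notation hyp := (hypothesis N K (goal M)).
Local Notation S := (score tr t).
Local Notation index_tuple := {ffun 'I_K -> nat}.

Variables (P : teams N K) (G : 'I_K -> seq (goal M)) (F : \bar R).
Hypothesis PM : P \in partitions M.
Hypothesis sortedG : sorted_goals tr L t P G.
Implicit Types (j q : index_tuple) (Q seen em : seq index_tuple).

Local Notation ts := (tuple_score tr L t P G).
Local Notation th := (tuple_hyp (M:=M) P G).

Definition in_range j : Prop := forall k, (j k < size (G k))%N.

Lemma mem_sorted_goals k g : (g \in G k) = (g \in goals M k).
Proof. by have [/perm_mem-> _] := sortedG k; rewrite mem_enum. Qed.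

Lemma uniq_sorted_goals k : uniq (G k).
Proof. by have [/perm_uniq-> _] := sortedG k; apply: enum_uniq. Qed.

Lemma in_range_start : in_range (start K).
Proof.
move=> k; rewrite ffunE; have := goal0P M k.
by rewrite -mem_sorted_goals; case: (G k).
Qed.

Lemma tuple_hyp_in j : in_range j -> th j \in hypotheses_of M P.
Proof.
move=> rj; rewrite !inE /= eqxx andbT PM; apply/forallP => k.
by rewrite ffunE -mem_sorted_goals mem_nth.
Qed.

Lemma score_tuple_hyp j : in_range j -> S (th j) = ts j.
Proof.
move=> rj; rewrite (scoreE nc) //; last first.
  by have := tuple_hyp_in rj; rewrite inE => /andP[].
by apply: eq_bigr => k _; rewrite /= ffunE.
Qed.

Lemma tuple_hyp_inj j j' : in_range j -> in_range j' -> th j = th j' -> j = j'.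
Proof.
move=> rj rj' [] /ffunP eq_sel; apply/ffunP => k.
have := eq_sel k; rewrite !ffunE => /eqP.
by rewrite nth_uniq ?uniq_sorted_goals // => /eqP.
Qed.

(** With [tuple_hyp_inj], this identifies the in-range tuples with the hypotheses of [P], so the
    search can be followed on tuples. *)
Lemma tuple_hyp_surj h : h \in hypotheses_of M P ->
  exists2 j, in_range j & h = th j.
Proof.
case: h => P' g; rewrite !inE /= => /andP[/andP[_ /forallP gG] /eqP->].
have gin k : g k \in G k by rewrite mem_sorted_goals.
exists [ffun k => index (g k) (G k)] => [k|]; first by rewrite ffunE index_mem.
by congr (_, _); apply/ffunP => k; rewrite ffunE /selected ffunE nth_index.
Qed.

Lemma tuple_score_antitone j j' : in_range j' -> (forall k, (j k <= j' k)%N) ->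
  ts j' <= ts j.
Proof.
move=> rj' le_jj'; apply: ler_sum => k _.
have [_ sG] := sortedG k.
apply: (sorted_leq_nth (leT := fun g g' => local_score tr L t k (P k) g' <=
  local_score tr L t k (P k) g)) => //; rewrite ?inE //.
- exact: (ge_transitive (f := local_score tr L t k (P k))).
- exact: leq_ltn_trans (rj' k).
Qed.

Lemma mem_successors j j' : reflect
  (exists2 k, ((j k).+1 < size (G k))%N & j' = succ_at j k)
  (j' \in successors (M:=M) G j).
Proof.
apply: (iffP mapP) => -[k].
  by rewrite mem_filter => /andP[rk _] ->; exists k.
by move=> rk ->; exists k; rewrite // mem_filter rk mem_enum.
Qed.

Lemma succ_at_inj j : injective (succ_at j).
Proof.
move=> k l /ffunP/(_ k); rewrite !ffunE eqxx.
by case: eqP => // _ /esym/n_Sn.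
Qed.

Lemma successors_uniq j : uniq (successors (M:=M) G j).
Proof.
rewrite map_inj_uniq; last exact: succ_at_inj.
exact/filter_uniq/enum_uniq.
Qed.

Lemma in_range_successor j j' : in_range j -> j' \in successors (M:=M) G j ->
  in_range j'.
Proof.
move=> rj /mem_successors[k rk ->] l; rewrite ffunE.
by case: eqP => [->|].
Qed.

(* em lists the tuples emitted so far. *)
Record frontier_inv Q seen em : Prop := FrontierInv {
  frontier_uniq : uniq Q;
  frontier_range : forall j, j \in seen -> in_range j;
  frontier_seen : forall j, (j \in seen) = (j \in Q) || (j \in em);
  frontier_disj : forall j, j \in Q -> j \notin em;
  frontier_start : start K \in seen;
  frontier_succ : forall j, j \in em ->
    {subset successors (M:=M) G j <= seen};
  frontier_em_uniq : uniq em;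
  frontier_best : forall j j', j \in em -> in_range j' -> j' \notin em ->
    ts j' <= ts j
}.

Lemma frontier_inv_start : frontier_inv [:: start K] [:: start K] [::].
Proof.
split=> //; rewrite ?mem_head // => j; rewrite ?inE ?orbF //.
by move/eqP->; apply: in_range_start.
Qed.

(* Walk from the start towards j inside the seen tuples; the walk can only be
   blocked at a tuple of the queue. *)
Lemma frontier_below Q seen em j : frontier_inv Q seen em ->
  in_range j -> j \notin em -> exists2 q, q \in Q & forall k, (q k <= j k)%N.
Proof.
move=> inv rj jem.
(* Induction on a strict bound [n] for the coordinate distance from the current tuple [s] to [j]. *)
suff walk n s : s \in seen -> (forall k, (s k <= j k)%N) ->
    (\sum_k (j k - s k) < n)%N -> exists2 q, q \in Q & forall k, (q k <= j k)%N.
  apply: (walk (\sum_k (j k - start K k)).+1 (start K)) => //.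
    exact: frontier_start inv.
  by move=> k; rewrite ffunE.
elim: n s => // n IH s sseen le_sj lt_n.
have := sseen; rewrite (frontier_seen inv) => /orP[sQ | sem]; first by exists s.
(* [s] is emitted and [j] is not, so they differ, and [s] lies below [j]. Raising such a coordinate
   gives a successor of [s], which is seen and closer to [j]. *)
have [k lt_sj] : exists k, (s k < j k)%N.
  apply/existsP/contraT => /existsPn ge_sj.
  case/negP: jem; rewrite (_ : j = s) //; apply/ffunP => k; apply/eqP.
  by rewrite eqn_leq le_sj andbT leqNgt ge_sj.
apply: (IH (succ_at s k)).
- apply: (frontier_succ inv sem); apply/mem_successors; exists k => //.
  exact: leq_ltn_trans lt_sj (rj k).
- by move=> l; rewrite ffunE; case: eqP => [->|].
- rewrite -ltnS; apply: leq_trans lt_n; rewrite ltnS.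
  rewrite (bigD1 k) //= [X in (_ < X)%N](bigD1 k) //= !ffunE eqxx.
  rewrite -addSn subnSK // leq_add2l; apply: leq_sum => l /negPf nlk.
  by rewrite ffunE nlk.
Qed.

Lemma frontier_queue_range Q seen em : frontier_inv Q seen em ->
  {in Q, forall q, in_range q}.
Proof.
by move=> inv q qQ; apply: (frontier_range inv); rewrite (frontier_seen inv) qQ.
Qed.

Lemma frontier_step Q seen em j : frontier_inv Q seen em ->
  j \in Q -> (forall j', j' \in Q -> ts j' <= ts j) ->
  let new := [seq j' <- successors (M:=M) G j | j' \notin seen] in
  frontier_inv (new ++ rem j Q) (new ++ seen) (j :: em).
Proof.
move=> inv jQ jmax new.
have rj : in_range j := frontier_queue_range inv jQ.
have uQ := frontier_uniq inv.
have jseen : j \in seen by rewrite (frontier_seen inv) jQ.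
have jem := frontier_disj inv jQ.
split.
- rewrite cat_uniq filter_uniq ?successors_uniq // rem_uniq // andbT /=.
  apply/hasPn => q /mem_rem qQ; rewrite /= mem_filter (frontier_seen inv).
  by rewrite qQ.
- move=> q; rewrite mem_cat mem_filter => /orP[/andP[_]|].
    exact: in_range_successor.
  exact: (frontier_range inv).
- move=> q; rewrite !mem_cat mem_rem_uniq // !inE (frontier_seen inv).
  have [->|_] := eqVneq q j; first by rewrite jQ !orbT.
  by rewrite /= orbA.
- move=> q; rewrite mem_cat mem_filter mem_rem_uniq // !inE negb_or.
  case/orP=> [/andP[qseen _]| /andP[-> /(frontier_disj inv)] //].
  move: (qseen); rewrite (frontier_seen inv) negb_or => /andP[_ ->].
  by rewrite andbT; apply: contraNneq qseen => ->.
- by rewrite mem_cat (frontier_start inv) orbT.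
- move=> q; rewrite inE => /predU1P[-> q' q'j | qem q' q'q]; rewrite mem_cat.
    by rewrite mem_filter q'j andbT orNb.
  by rewrite (frontier_succ inv qem) ?orbT.
- by rewrite /= jem (frontier_em_uniq inv).
(* Maximality of [j] within the queue extends to all unemitted tuples, since each lies above some
   tuple of the queue. *)
- move=> e j'; rewrite !inE negb_or => eem rj' /andP[_ j'em].
  case/predU1P: eem => [-> | eem]; last exact: (frontier_best inv).
  have [q qQ le_qj'] := frontier_below inv rj' j'em.
  exact: le_trans (tuple_score_antitone rj' le_qj') (jmax _ qQ).
Qed.

Lemma local_stop_dominated Q seen em H (E : {set hyp}) j :
  ~~ local_guard tr L m t P G F Q (size em) H -> frontier_inv Q seen em ->
  top_entries tr m t (E :|: [set h in map th em]) H ->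
  valid_threshold tr m t F H ->
  in_range j -> j \notin em ->
  full (M:=M) m H /\ forall y, y \in H -> S (th j) <= S y.
Proof.
move=> stop inv topH [leF _] rj jem.
have [q qQ le_qj] := frontier_below inv rj jem.
have remE e : e \in em -> S (th e) = ts e.
  move=> eem; apply: score_tuple_hyp.
  by apply: (frontier_range inv); rewrite (frontier_seen inv) eem orbT.
have uem : uniq (map th em).
  rewrite map_inj_in_uniq ?(frontier_em_uniq inv) // => a b aem bem.
  by apply: tuple_hyp_inj; apply: (frontier_range inv);
    rewrite (frontier_seen inv) ?aem ?bem orbT.
have memE e : e \in em -> th e \in E :|: [set h in map th em].
  by move=> eem; rewrite !inE map_f ?orbT.
have [uH _ mH domH] := topH.
rewrite /local_guard in stop; rewrite score_tuple_hyp //.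
have Qn0 : Q != [::] by case: (Q) qQ.
rewrite Qn0 /= negb_and -leqNgt negb_or negbK -leNgt in stop.
(* As the queue is nonempty, either m tuples were emitted, or the heap is full and no tuple of the
   queue beats [F]; in the latter case ts j <= ts q <= F <= S y. *)
case/orP: stop => [em_m | /andP[fH best_le]]; last first.
  split=> // y yH; rewrite -lee_fin; apply: le_trans (leF _ yH).
  apply: le_trans best_le; apply: bigmax_sup_seq qQ _ _ => //.
  by rewrite lee_fin tuple_score_antitone.
(* The emitted hypotheses are at least m distinct ones, and a heap with room would contain them
   all. *)
have fH : full (M:=M) m H.
  apply/contraT => nfH; rewrite -(negPf nfH) /full; apply: leq_trans em_m _.
  rewrite -(size_map th); apply: uniq_leq_size => // _ /mapP[e eem ->].
  by apply/contraT => /(domH _ (memE e eem))[]; rewrite (negPf nfH).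
(* A heap entry [y] worse than [j] would be worse than every emitted tuple. All of these would then
   be in the heap together with [y], giving more than m entries. *)
split=> // y yH; rewrite leNgt; apply/negP => lt_yj.
have emH e : e \in em -> ts j <= ts e by move=> eem; apply: (frontier_best inv).
suff: (size (y :: map th em) <= size H)%N.
  by rewrite /= size_map leqNgt ltnS (leq_trans mH em_m).
apply: uniq_leq_size => /=.
  rewrite uem andbT; apply/mapP => -[e eem ye].
  by move: lt_yj; rewrite ye remE // ltNge emH.
move=> z; rewrite inE => /predU1P[-> // | /mapP[e eem ->]].
apply/contraT => /(domH _ (memE e eem))[_ /(_ y yH)].
by rewrite remE // leNgt (lt_le_trans lt_yj) // emH.
Qed.

(** Induction on the run: the heap selects from [E] and the emitted hypotheses, and on exit the
    remaining ones of [P] join at once, being dominated. Since [E] avoids [P], each popped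
    hypothesis is new. *)
Lemma local_loop_top Q seen n H H' :
  local_loop tr L m t P G F Q seen n H H' ->
  forall (E : {set hyp}) em, n = size em -> frontier_inv Q seen em ->
    {in E, forall h, h.1 != P} ->
    top_entries tr m t (E :|: [set h in map th em]) H ->
    valid_threshold tr m t F H ->
    top_entries tr m t (E :|: hypotheses_of M P) H'.
Proof.
elim=> {Q seen n H H'} [Q seen n H | Q seen n H j H1 H2] stop.
  move=> E em n_em inv disE topH thrH; apply: (top_entriesW topH).
    apply: setUS; apply/subsetP => h; rewrite inE => /mapP[e eem ->].
    apply: tuple_hyp_in; apply: (frontier_range inv).
    by rewrite (frontier_seen inv) eem orbT.
  move=> h; rewrite in_setU => /orP[hE | /tuple_hyp_surj[j rj ->]].
    by rewrite in_setU hE.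
  rewrite in_setU negb_or inE => /andP[_ jem]; rewrite n_em in stop.
  apply: (local_stop_dominated stop inv topH thrH rj).
  by apply: contra jem; apply: map_f.
move=> jQ jmax ins _ IH E em n_em inv disE topH thrH.
have rj := frontier_queue_range inv jQ.
apply: (IH E (j :: em)) => //=.
- by rewrite n_em.
- exact: frontier_step.
- rewrite set_cons setUCA; apply: heap_insert_top ins topH _.
  rewrite !in_setU inE negb_or; apply/andP; split.
    by apply/negP => /disE; rewrite eqxx.
  apply/mapP => -[e eem /tuple_hyp_inj je].
  have := frontier_disj inv jQ; rewrite je ?eem //.
  by apply: (frontier_range inv); rewrite (frontier_seen inv) eem orbT.
- exact: heap_insert_threshold ins thrH.
Qed.

(** Each iteration uses up one of the m - n emissions still allowed. *)
Lemma local_loop_exists Q seen n H :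
  exists H', local_loop tr L m t P G F Q seen n H H'.
Proof.
have [d] := ubnP (m - n); elim: d => // d IH in Q seen n H *.
rewrite ltnS => le_d.
have [guard | stop] := boolP (local_guard tr L m t P G F Q n H); last first.
  by exists H; left.
have /and3P[Qn0 ltnm _] := guard.
have [j jQ jmax] := seq_argmax ts Qn0.
have [H1 ins] := heap_insert_exists tr m t (th j) H.
have lt_d : (m - n.+1 < d)%N by apply: leq_trans le_d; rewrite subnSK.
set new := [seq j' <- successors (M:=M) G j | j' \notin seen].
have [H2 loop] := IH (new ++ rem j Q) (new ++ seen) n.+1 H1 lt_d.
by exists H2; apply: LoopStep ins loop.
Qed.

End LocalSearch.

(** * One step of a recognizer, for an arbitrary variant *)

Section Recognizer.
Variables (R : realType) (N K : nat) (M : model R N K) (tr : trajectory M).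
Variables (L : local_data M) (v : variant) (m t : nat).
Hypothesis nc : noncompetitive tr L.
Hypothesis t_range : (0 < t <= horizon tr)%N.
Hypothesis m_gt0 : (0 < m)%N.
Local Notation hyp := (hypothesis N K (goal M)).
Local Notation S := (score tr t).
Implicit Types (D : {set teams N K}) (P : teams N K) (H : seq hyp).

Definition hypotheses_in D : {set hyp} := [set h in hypotheses M | h.1 \in D].

Lemma hypotheses_inU1 D P :
  hypotheses_in (P |: D) = hypotheses_in D :|: hypotheses_of M P.
Proof.
apply/setP => h; rewrite in_setU !in_set.
by rewrite in_set1 -andb_orr orbC.
Qed.

Lemma search_top P F H H' D : search tr L v m t P F H H' ->
  P \in partitions M -> P \notin D ->
  top_entries tr m t (hypotheses_in D) H -> valid_threshold tr m t F H ->
  top_entries tr m t (hypotheses_in (P |: D)) H'.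
Proof.
move=> srch PM PD topH thrH; rewrite hypotheses_inU1.
have disD : {in hypotheses_in D, forall h, h.1 != P}.
  by move=> h; rewrite inE => /andP[_]; apply: contraTneq => ->.
case: srch => [G _ sortedG loop | hs _ hsP emit].
  apply: (local_loop_top nc t_range PM sortedG loop (em := [::])) => //.
    exact: frontier_inv_start.
  by rewrite (_ : [set h in map _ [::]] = set0) ?setU0 //; apply/setP=> x; rewrite !inE.
rewrite (_ : hypotheses_of M P = [set h in hs]); last first.
  by apply/setP => h; rewrite [RHS]inE (perm_mem hsP) mem_enum.
have uhs : uniq hs by rewrite (perm_uniq hsP) enum_uniq.
apply: (emit_all_top emit topH uhs).
move=> h; rewrite (perm_mem hsP) mem_enum inE => /andP[_ /eqP hP].
by apply/negP => /disD; rewrite hP eqxx.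
Qed.

Lemma sorted_goals_exist P : exists G, sorted_goals tr L t P G.
Proof.
exists (fun k => sort (fun g g' => local_score tr L t k (P k) g' <=
  local_score tr L t k (P k) g) (enum (goals M k))) => k.
by rewrite perm_sort sort_sorted //; apply: ge_total.
Qed.

Lemma search_exists P F H : exists H', search tr L v m t P F H H'.
Proof.
have [loc | nloc] := boolP (local_stage v).
  have [G sortedG] := sorted_goals_exist P.
  have [H' loop] := local_loop_exists tr L m t P G F [:: start K] [:: start K] 0 H.
  by exists H'; apply: SearchLocal loop.
have [H' emit] := emit_all_exists tr m t (enum (hypotheses_of M P)) H.
by exists H'; apply: SearchAll emit.
Qed.

Variable stale : teams N K -> R.
Hypothesis stale_ge : forall P, bound tr L t P <= stale P.

Lemma process_top P F H H' D : process tr L v m t stale P F H H' ->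
  P \in partitions M -> P \notin D ->
  top_entries tr m t (hypotheses_in D) H -> valid_threshold tr m t F H ->
  top_entries tr m t (hypotheses_in (P |: D)) H'.
Proof.
move=> proc PM PD topH thrH.
(* One argument for both tests: [x] is the stale bound when skipping and the current bound when
   dropping, and S h <= bound <= x <= F <= S y. *)
have prune x : full (M:=M) m H -> bound tr L t P <= x -> (x%:E <= F)%E ->
    top_entries tr m t (hypotheses_in (P |: D)) H.
  move=> fH le_x xF; rewrite hypotheses_inU1.
  apply: (top_entriesW topH); first exact: subsetUl.
  move=> h; rewrite in_setU => /orP[-> //|]; rewrite inE => /andP[hM /eqP hP] _.
  split=> // y yH; rewrite -lee_fin; have [leF _] := thrH.
  apply: le_trans (le_trans xF (leF _ yH)); rewrite lee_fin.
  by apply: le_trans le_x; rewrite -hP; apply: score_le_bound.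
case: proc => [/and3P[_ fH xF] | _ /and3P[_ fH xF] | {}H' _ _ srch].
- exact: prune xF.
- exact: prune xF.
- exact: search_top srch _ _ _ thrH.
Qed.

Lemma process_exists P F H : exists H', process tr L v m t stale P F H H'.
Proof.
have [sk | nsk] := boolP (skips (M:=M) v m stale P F H).
  by exists H; apply: ProcessSkip.
have [dr | ndr] := boolP (drops tr L v m t P F H).
  by exists H; apply: ProcessDrop.
by have [H' srch] := search_exists P F H; exists H'; apply: ProcessSearch srch.
Qed.

Lemma pass_top Ps F H H' rf : pass tr L v m t stale Ps F H H' rf ->
  forall D, uniq Ps -> {in Ps, forall P, P \in partitions M /\ P \notin D} ->
  top_entries tr m t (hypotheses_in D) H -> valid_threshold tr m t F H ->
  top_entries tr m t (hypotheses_in (D :|: [set P in Ps])) H'.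
Proof.
elim=> [{}F {}H D _ _ | P {}Ps {}F {}H H1 H2 {}rf proc _ IH D].
  by rewrite (_ : [set P in [::]] = set0) ?setU0 //; apply/setP=> x; rewrite !inE.
move=> /= /andP[PPs uPs] inPs topH thrH.
have [PM PD] := inPs P (mem_head _ _).
have topH1 := process_top proc PM PD topH thrH.
rewrite set_cons setUCA setUA; apply: IH => //.
  move=> Q QPs; have [|QM QD] := inPs Q; first by rewrite inE QPs orbT.
  by rewrite !inE negb_or QD andbT; split=> //; apply: contraNneq PPs => <-.
(* The next threshold is the heap minimum if the heap is full. Otherwise the earlier heap was not
   full either, so [F] is still -oo. *)
split=> [y yH1 | nfH1].
  case: ifP => [_ | /negbT nfH1]; first by apply: ge_bigmin_seq.
  suff -> : F = -oo%E by rewrite leNye.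
  have [_ -> //] := thrH; apply: contra nfH1.
  by apply: (top_entries_full topH topH1); rewrite hypotheses_inU1 subsetUl.
rewrite (negPf nfH1); have [_ -> //] := thrH; apply: contra nfH1.
by apply: (top_entries_full topH topH1); rewrite hypotheses_inU1 subsetUl.
Qed.

Lemma pass_exists Ps F H : exists H' rf, pass tr L v m t stale Ps F H H' rf.
Proof.
elim: Ps F H => [|P Ps IH] F H; first by exists H, [::]; left.
have [H1 proc] := process_exists P F H.
have [H2 [rf ps]] := IH (if full (M:=M) m H1 then heap_min tr t H1 else F) H1.
by eexists; eexists; apply: PassCons proc ps.
Qed.

Lemma step_top r stale' : step tr L v m t stale r stale' ->
  top_entries tr m t (hypotheses M) r /\ ranked tr t r.
Proof.
case=> Ps [H [rf [[permPs _] ps [rH rk] _]]]; split=> //.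
apply: top_entries_perm rH _.
have -> : hypotheses M = hypotheses_in (set0 :|: [set P in Ps]).
  apply/setP => h; rewrite set0U !in_set (perm_mem permPs) mem_enum.
  by case: (h.1 \in partitions M); rewrite ?andbT ?andbF.
apply: (pass_top ps); rewrite ?(perm_uniq permPs) ?enum_uniq //.
- by move=> P; rewrite (perm_mem permPs) mem_enum inE.
- by split=> // h; rewrite !inE andbF.
Qed.

End Recognizer.

(** * Runs from the first step and admissibility of stale bounds *)

Section Runs.
Variables (R : realType) (N K : nat) (M : model R N K) (tr : trajectory M).
Variables (L : local_data M) (v : variant) (m : nat).

Lemma step_exists t stale : exists r stale', step tr L v m t stale r stale'.
Proof.
pose Ps := sort (fun P P' => stale P' <= stale P) (enum (partitions M)).
have [H [rf ps]] := pass_exists tr L v m t stale Ps -oo%E [::].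
exists (sort (fun h h' => score tr t h' <= score tr t h) H); eexists.
exists Ps, H, rf; split=> //; rewrite perm_sort; split=> //.
  by apply: sort_sorted; apply: ge_total.
by apply: sort_sorted; apply: ge_total.
Qed.

Lemma stale_after_exists t : exists b, stale_after tr L v m t b.
Proof.
elim: t => [|t [b sb]]; first by exists (fun=> 0); left.
by have [r [b' stp]] := step_exists t.+1 b; exists b'; apply: StaleStep stp.
Qed.

Lemma returns_exists t : exists r, returns tr L v m t r.
Proof.
have [b sb] := stale_after_exists t.-1.
by have [r [b' stp]] := step_exists t b; exists r, b, b'.
Qed.

(** Stated for all later [t'] because a bound may stay unrefreshed over many steps; a refreshed one
    remains valid by monotonicity in time. *)
Lemma stale_after_ge t b : stale_after tr L v m t b ->
  forall t', (t <= t' <= horizon tr)%N -> forall P, bound tr L t' P <= b P.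
Proof.
elim=> [|{}t {}b r b' _ IH [Ps [H [rf [_ _ _ ->]]]]] t' t_t' P.
  exact: bound_le0.
case: ifP => _; first exact: bound_nonincreasing.
by case/andP: t_t' => lt_tt' le_t'; apply: IH; rewrite ltnW.
Qed.

(** Holds for every [v], exhaustive search included; rankings of two variants are compared through
    this property alone. *)
Lemma returns_top t r : noncompetitive tr L -> (0 < t <= horizon tr)%N ->
  (0 < m)%N -> returns tr L v m t r ->
  top_entries tr m t (hypotheses M) r /\ ranked tr t r.
Proof.
move=> nc t_range m_gt0 [b [b' [sb stp]]]; apply: step_top stp => //.
by apply: (stale_after_ge sb); rewrite leq_pred; case/andP: t_range.
Qed.

End Runs.

(** * Ranked top-m selections against the sorted list of all scores *)

Section Ranking.
Variables (R : realType) (N K : nat) (M : model R N K) (tr : trajectory M).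
Variables (m t : nat) (sigma : seq R).
Local Notation hyp := (hypothesis N K (goal M)).
Local Notation S := (score tr t).
Hypothesis m_range : (0 < m < #|hypotheses M|)%N.
Hypothesis perm_sigma : perm_eq sigma [seq S h | h <- enum (hypotheses M)].
Hypothesis sorted_sigma : sorted (fun x y : R => y <= x) sigma.
Variable r : seq hyp.
Hypothesis top_r : top_entries tr m t (hypotheses M) r.

(** A selection with room left would contain all hypotheses, which are more than m. *)
Lemma top_entries_size : size r = m.
Proof.
have [ur sr mr dom] := top_r; case/andP: m_range => _ lt_mM.
apply/eqP; rewrite eqn_leq mr /=; apply/contraT => nfr.
suff: (#|hypotheses M| <= size r)%N by rewrite leqNgt (leq_ltn_trans mr).
rewrite cardE; apply: uniq_leq_size; first exact: enum_uniq.
move=> h; rewrite mem_enum => hM; apply/contraT => hr.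
by have [] := dom h hM hr; rewrite /full (negPf nfr).
Qed.

Hypothesis ranked_r : ranked tr t r.

(** The omitted hypotheses, sorted and appended to [r], keep the scores nonincreasing because [r]
    dominates them; a sorted rearrangement of the scores is unique. *)
Lemma ranking_split : exists2 rest,
    sigma = map S r ++ map S rest & perm_eq (r ++ rest) (enum (hypotheses M)).
Proof.
have [ur sr mr dom] := top_r.
pose rest := sort (fun h h' => S h' <= S h) [seq h <- enum (hypotheses M) | h \notin r].
have permr : perm_eq (r ++ rest) (enum (hypotheses M)).
  rewrite perm_sym -(perm_filterC (mem r)) perm_cat //; last first.
    by rewrite perm_sym perm_sort.
  apply: uniq_perm => //; first exact/filter_uniq/enum_uniq.
  move=> h; rewrite mem_filter mem_enum.
  by apply/andP/idP => [[] // | hr]; split=> //; apply: sr.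
exists rest => //; apply: (sorted_eq (leT := fun x y => y <= x)) => //.
- exact: (ge_transitive (f := id)).
- by move=> x y /andP[xy yx]; apply/le_anti; rewrite xy yx.
- rewrite -map_cat sorted_map /relpre sorted_pairwise; last first.
    exact: (ge_transitive (f := S)).
  rewrite pairwise_cat -!sorted_pairwise; try exact: (ge_transitive (f := S)).
  rewrite [sorted _ r]ranked_r /= sort_sorted ?andbT; last exact: ge_total.
  apply/allrelP => x y xr; rewrite mem_sort mem_filter mem_enum => /andP[yr yM].
  by have [_] := dom y yM yr; apply.
- by rewrite -map_cat; apply: perm_trans perm_sigma _; rewrite perm_sym perm_map.
Qed.

Lemma ranking_scores : map S r = take m sigma.
Proof.
have [rest -> _] := ranking_split.
by rewrite -top_entries_size -(size_map S) take_size_cat.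
Qed.

Lemma size_sigma : size sigma = #|hypotheses M|.
Proof. by rewrite (perm_size perm_sigma) size_map cardE. Qed.

(** Positions count from 0: the entries of [sigma] at [m.-1] and [m] are $\sigma_m$ and
    $\sigma_{m+1}$. *)
Lemma ranking_score_ge h : h \in r -> nth 0 sigma m.-1 <= S h.
Proof.
move=> hr; have [_ lt_mM] := andP m_range; have [m_gt0 _] := andP m_range.
have: S h \in take m sigma by rewrite -ranking_scores map_f.
case/(nthP 0) => i; rewrite size_takel ?size_sigma ?(ltnW lt_mM) // => lt_im.
rewrite nth_take // => <-.
apply: (sorted_leq_nth (leT := fun x y => y <= x)) => //; rewrite ?inE ?size_sigma.
- exact: (ge_transitive (f := id)).
- exact: ltn_trans lt_mM.
- by rewrite prednK // ltnW.
- by rewrite -ltnS prednK.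
Qed.

Lemma ranking_score_le h : h \in hypotheses M -> h \notin r ->
  S h <= nth 0 sigma m.
Proof.
move=> hM hr; have [_ lt_mM] := andP m_range.
have [rest sigmaE permr] := ranking_split.
have hrest : h \in rest.
  by have := perm_mem permr h; rewrite mem_cat mem_enum hM (negPf hr).
have size_r : size (map S r) = m by rewrite size_map top_entries_size.
have: S h \in drop m sigma by rewrite sigmaE drop_size_cat ?map_f.
case/(nthP 0) => i; rewrite size_drop size_sigma nth_drop => lt_i <-.
apply: (sorted_leq_nth (leT := fun x y => y <= x)) => //; rewrite ?inE ?size_sigma //.
- exact: (ge_transitive (f := id)).
- by rewrite -ltn_subRL.
- exact: leq_addr.
Qed.

(** The criterion does not mention [r], so any two top-m selections have the same members. *)
Lemma ranking_mem_gap h : nth 0 sigma m < nth 0 sigma m.-1 ->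
  (h \in r) = (h \in hypotheses M) && (nth 0 sigma m.-1 <= S h).
Proof.
move=> gap; have [_ sr _ _] := top_r.
apply/idP/andP => [hr | [hM]]; first by rewrite sr ?ranking_score_ge.
by rewrite leNgt; apply: contraR => /(ranking_score_le hM)/le_lt_trans; apply.
Qed.

Lemma ranking_mem_tie h : nth 0 sigma m.-1 = nth 0 sigma m ->
  S h != nth 0 sigma m.-1 ->
  (h \in r) = (h \in hypotheses M) && (nth 0 sigma m.-1 < S h).
Proof.
move=> tie neq; have [_ sr _ _] := top_r.
apply/idP/andP => [hr | [hM]].
  by rewrite sr // lt_neqAle eq_sym neq ranking_score_ge.
by rewrite ltNge tie; apply: contraR; apply: ranking_score_le.
Qed.

End Ranking.

(** * Comparison of a pruned variant with exhaustive search *)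

Theorem mainTheorem2 (R : realType) (N K : nat) (M : model R N K)
    (tr : trajectory M) (L : local_data M) (m t : nat) (sigma : seq R)
    (v : variant) :
  noncompetitive tr L ->
  (0 < t <= horizon tr)%N ->
  (0 < m < #|hypotheses M|)%N ->
  perm_eq sigma [seq score tr t h | h <- enum (hypotheses M)] ->
  sorted (fun x y => y <= x) sigma ->
  v <> Exhaustive ->
  (exists r, returns tr L Exhaustive m t r) /\
  (exists r, returns tr L v m t r) /\
  forall r r_ex, returns tr L v m t r -> returns tr L Exhaustive m t r_ex ->
    (nth 0 sigma m.-1 > nth 0 sigma m ->
       [/\ size r = m, uniq r, {subset r <= hypotheses M}, perm_eq r r_ex &
           ranked tr t r && ranked tr t r_ex]) /\
    (nth 0 sigma m.-1 = nth 0 sigma m ->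
       [/\ uniq r, {subset r <= hypotheses M},
           [seq score tr t h | h <- r] = take m sigma,
           (forall h, h \in hypotheses M ->
              score tr t h > nth 0 sigma m.-1 -> h \in r) &
           (forall h, score tr t h != nth 0 sigma m.-1 ->
              (h \in r) = (h \in r_ex))]).
Proof.
move=> nc t_range m_range perm_sigma sorted_sigma _.
split; first exact: returns_exists.
split; first exact: returns_exists.
have [m_gt0 _] := andP m_range.
move=> r r_ex /(returns_top nc t_range m_gt0)[top_r rk_r].
move=> /(returns_top nc t_range m_gt0)[top_ex rk_ex].
have [ur sr _ _] := top_r; have [uex _ _ _] := top_ex.
split=> [gap | tie]; split=> //.
- exact: (top_entries_size m_range top_r).
- apply: uniq_perm => // h.
  rewrite (ranking_mem_gap m_range perm_sigma sorted_sigma top_r rk_r) //.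
  by rewrite (ranking_mem_gap m_range perm_sigma sorted_sigma top_ex rk_ex).
- by rewrite rk_r rk_ex.
- exact: (ranking_scores m_range perm_sigma sorted_sigma top_r rk_r).
- move=> h hM gt_h.
  rewrite (ranking_mem_tie m_range perm_sigma sorted_sigma top_r rk_r) ?hM //.
  by rewrite gt_eqF.
- move=> h neq_h.
  rewrite (ranking_mem_tie m_range perm_sigma sorted_sigma top_r rk_r) //.
  by rewrite (ranking_mem_tie m_range perm_sigma sorted_sigma top_ex rk_ex).
Qed.
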